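(* Let $T>0$ and let $v\colon \mathbb{R}\times\mathbb{R}\times\mathbb{R}\to\mathbb{R}$, $(t,x,\dot x)\mapsto v(t,x,\dot x)$, be an infinitely smooth function that is $T$-periodic in $t$. Suppose there exist two infinitely smooth $T$-periodic functions $x_1,x_2\colon\mathbb{R}\to\mathbb{R}$ such that for all $t\in\mathbb{R}$: 1. $x_1(t)<x_2(t)$; 2. $\ddot x_1(t)>v(t,x_1(t),\dot x_1(t))$; 3. $\ddot x_2(t)<v(t,x_2(t),\dot x_2(t))$. Assume moreover that there are constants $a$, $b$ and $\delta>0$ such that $v(t,x,\dot x)\leqslant a+b|\dot x|^{2-\delta}$ for all $t,x,\dot x$. Then the equation $\ddot x=v(t,x,\dot x)$ has a $T$-periodic solution $x(t)$ such that $x_1(t)<x(t)<x_2(t)$ for all $t\in\mathbb{R}$.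
   Context: Dots denote derivatives with respect to $t$; when used as an argument of $v$, $\dot x$ is an independent real variable. A function $g$ of $t$ (and possibly other variables) is called $T$-periodic in $t$ if its value is unchanged when $t$ is replaced by $t+T$. *)

(* Defs.v *)
From Stdlib Require Import Reals.
From Coquelicot Require Import Coquelicot.
Open Scope R_scope.

Definition periodic (T : R) (f : R -> R) : Prop :=
  forall t, f (t + T) = f t.

Definition periodic_in_t (T : R) (v : R -> R -> R -> R) : Prop :=
  forall t x y, v (t + T) x y = v t x y.

Definition smooth (f : R -> R) : Prop :=
  forall (n : nat) (t : R), ex_derive_n f n t.

Definition partial1 (f : R -> R -> R -> R) (t x y : R) : R :=
  Derive (fun s => f s x y) t.
Definition partial2 (f : R -> R -> R -> R) (t x y : R) : R :=
  Derive (fun s => f t s y) x.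
Definition partial3 (f : R -> R -> R -> R) (t x y : R) : R :=
  Derive (fun s => f t x s) y.

Definition jointly_continuous (f : R -> R -> R -> R) : Prop :=
  forall p : R * R * R,
    continuous (fun q : R * R * R => f (fst (fst q)) (snd (fst q)) (snd q)) p.

(* Class C^n: all iterated partial derivatives of order at most n, mixed ones
   in any order included, exist everywhere and are jointly continuous. *)
Fixpoint C_n (n : nat) (f : R -> R -> R -> R) : Prop :=
  jointly_continuous f /\
  match n with
  | O => True
  | S m =>
      (forall t x y,
         ex_derive (fun s => f s x y) t /\
         ex_derive (fun s => f t s y) x /\
         ex_derive (fun s => f t x s) y) /\
      C_n m (partial1 f) /\ C_n m (partial2 f) /\ C_n m (partial3 f)
  end.

Definition smooth3 (f : R -> R -> R -> R) : Prop :=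
  forall n : nat, C_n n f.

(* The power |y|^e. [Rpower] alone would be wrong at y = 0, where [ln 0 = 0]
   gives [Rpower 0 e = 1]. The usual values at y = 0 are 0 for e > 0 and 1 for
   e = 0; for e < 0 the power is undefined there and 0 is a placeholder. *)
Definition abs_power (y e : R) : R :=
  if Req_EM_T y 0 then (if Req_EM_T e 0 then 1 else 0)
  else Rpower (Rabs y) e.

(* [ex_derive x t] is stated separately because [Derive x] is a total function,
   whose differentiability does not imply that of x. *)
Definition is_solution (v : R -> R -> R -> R) (x : R -> R) : Prop :=
  forall t, ex_derive x t /\ is_derive (Derive x) t (v t (x t) (Derive x t)).

(* Main.v *)
Require Import Defs.
From Stdlib Require Import Reals ZArith Lra Lia ClassicalEpsilon.
From Coquelicot Require Import Coquelicot.
Open Scope R_scope.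

(** The functions [x1] and [x2] are a lower and an upper solution, and the
    periodic solution is reached from [x1] by monotone iteration.

    First [v] is truncated: its argument [x] is clamped between [x1 t] and [x2 t], and
    [y] between [- M] and [M]. The result [F] is bounded, and Lipschitz in [(x, y)] with some
    constant [K], since [v] is C^1 and the arguments now stay in a compact set
    ([box_bounded], [C1_lipschitz_on_box]).

    With [lam = K + 1], let [u_(n+1)] be the [T]-periodic solution of
    [u'' - lam^2 u = F(t, u_n, u_n') - lam^2 u_n], starting from [u_0 = x1]. As
    long as [u_n] is a lower solution, the increment [w = u_(n+1) - u_n]
    satisfies [w'' - lam^2 w <= 0]; factoring the operator into two periodic
    first-order problems gives [|w'| <= lam w] ([periodic_derivative_control]).
    So the sequence increases, and the dependence of [F] on [u'] is controlled by
    [w] itself, which makes [u_(n+1)] a lower solution again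
    ([iterate_step_lower]). Every periodic lower solution of [F] lies below [x2]:
    at a maximum of [u - x2] with [x2 <= u] the clamping makes [F] take the value
    [v(t, x2, x2')], and the second derivatives contradict the maximum
    ([strict_comparison]). Hence the [u_n] converge; the bound [|w'| <= lam w]
    makes the [u_n'] converge as well, and the limit solves [x'' = F(t, x, x')]
    ([solution_above_lower_solution]).

    It remains to see that the truncation is not felt. For [|y| >= 1] the growth
    condition gives [F <= C y^2] with a [C] that does not depend on [M]. Where
    [x' >= 1], the function [x' exp (- C x)] therefore decreases, and since [x']
    vanishes in every period, [|x'|] is bounded in terms of [C] and of the bound
    on [x1] and [x2] ([derivative_bound]); [M] is chosen larger than this. The
    strict inequalities follow from the comparison at a contact point. *)

(** * Calculus of one variable *)

Lemma mean_value (f f' : R -> R) (a b : R) :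
  a < b -> (forall c, a <= c <= b -> is_derive f c (f' c)) ->
  exists c, a < c < b /\ f b - f a = f' c * (b - a).
Proof.
  intros hab hf.
  destruct (MVT_cor2 f f' a b hab) as [c [hc1 hc2]].
  - intros c hc. apply is_derive_Reals. now apply hf.
  - now exists c.
Qed.

Lemma decreasing_of_derive_le0 (f f' : R -> R) (a b : R) :
  a <= b -> (forall c, a <= c <= b -> is_derive f c (f' c)) ->
  (forall c, a < c < b -> f' c <= 0) -> f b <= f a.
Proof.
  intros hab hf hneg.
  destruct (Rle_lt_or_eq_dec a b hab) as [hlt | ->]; [ | lra].
  destruct (mean_value f f' a b hlt hf) as [c [hc heq]].
  specialize (hneg c hc). nra.
Qed.

Lemma mean_value_abs (f f' : R -> R) (K a b : R) :
  (forall c, Rmin a b <= c <= Rmax a b -> is_derive f c (f' c)) ->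
  (forall c, Rmin a b <= c <= Rmax a b -> Rabs (f' c) <= K) ->
  Rabs (f b - f a) <= K * Rabs (b - a).
Proof.
  intros hf hK.
  destruct (MVT_gen f a b f') as [c [hc heq]].
  - intros x hx. apply hf. lra.
  - intros x hx. apply continuity_pt_filterlim.
    apply (ex_derive_continuous f). exists (f' x). now apply hf.
  - rewrite heq, Rabs_mult. apply Rmult_le_compat_r; [apply Rabs_pos | auto].
Qed.

Lemma continuous_of_ex_derive (f : R -> R) (t : R) :
  ex_derive f t -> continuous f t.
Proof. apply (ex_derive_continuous f). Qed.

Lemma max_first_second_order (f : R -> R) (t : R) :
  (forall s, ex_derive f s) -> ex_derive (Derive f) t ->
  (forall s, f s <= f t) -> Derive f t = 0 /\ Derive (Derive f) t <= 0.
Proof.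
  intros hf hf2 hmax.
  assert (hd : forall s, is_derive f s (Derive f s)).
  { intros s. now apply Derive_correct. }
  (* The increment of [f] on either side of the maximum has a known sign, and
     so has [Derive f] at some point arbitrarily close on that side. *)
  assert (hright : forall h, 0 < h -> exists c, t < c < t + h /\ Derive f c <= 0).
  { intros h hh.
    destruct (mean_value f (Derive f) t (t + h)) as [c [hc heq]]; [lra | auto | ].
    exists c. split; [exact hc | ]. specialize (hmax (t + h)). nra. }
  assert (hleft : forall h, 0 < h -> exists c, t - h < c < t /\ 0 <= Derive f c).
  { intros h hh.
    destruct (mean_value f (Derive f) (t - h) t) as [c [hc heq]]; [lra | auto | ].
    exists c. split; [exact hc | ]. specialize (hmax (t - h)). nra. }
  assert (h0 : Derive f t = 0).
  { assert (hc := continuous_of_ex_derive _ _ hf2).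
    destruct (Rtotal_order (Derive f t) 0) as [hlt | [heq | hgt]]; [ | exact heq | ].
    - destruct (proj1 (filterlim_locally _ _) hc (mkposreal (- Derive f t) ltac:(lra)))
        as [d hd'].
      destruct (hleft d (cond_pos d)) as [c [hc1 hc2]].
      assert (hb : ball t d c).
      { change (Rabs (c - t) < d). apply Rabs_def1; lra. }
      apply hd' in hb. change (Rabs (Derive f c - Derive f t) < - Derive f t) in hb.
      apply Rabs_def2 in hb. lra.
    - destruct (proj1 (filterlim_locally _ _) hc (mkposreal (Derive f t) hgt)) as [d hd'].
      destruct (hright d (cond_pos d)) as [c [hc1 hc2]].
      assert (hb : ball t d c).
      { change (Rabs (c - t) < d). apply Rabs_def1; lra. }
      apply hd' in hb. change (Rabs (Derive f c - Derive f t) < Derive f t) in hb.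
      apply Rabs_def2 in hb. lra. }
  split; [exact h0 | ].
  apply Rnot_lt_le. intros hpos.
  assert (hdd := Derive_correct _ _ hf2). apply is_derive_Reals in hdd.
  destruct (hdd _ hpos) as [d hd'].
  destruct (hright d (cond_pos d)) as [c [hc1 hc2]].
  specialize (hd' (c - t) ltac:(lra)).
  rewrite Rabs_pos_eq in hd' by lra. specialize (hd' ltac:(lra)).
  replace (t + (c - t)) with c in hd' by ring. rewrite h0 in hd'.
  assert (hq : (Derive f c - 0) / (c - t) <= 0).
  { apply Rmult_le_reg_r with (c - t); [lra | ].
    field_simplify; lra. }
  apply Rabs_def2 in hd'. lra.
Qed.

(** Comparison principle at a contact point: where [u - w] is largest, the two
    functions are tangent and [u] curves at most as much as [w]. *)
Lemma contact_order (u w : R -> R) (t : R) :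
  (forall s, ex_derive u s /\ ex_derive (Derive u) s) ->
  (forall s, ex_derive w s /\ ex_derive (Derive w) s) ->
  (forall s, u s - w s <= u t - w t) ->
  Derive u t = Derive w t /\ Derive (Derive u) t <= Derive (Derive w) t.
Proof.
  intros hu hw hmax.
  assert (hD : forall s, Derive (fun r => u r - w r) s = Derive u s - Derive w s).
  { intros s. apply Derive_minus; [apply hu | apply hw]. }
  destruct (max_first_second_order (fun s => u s - w s) t) as [h1 h2].
  - intros s. apply (ex_derive_minus u w); [apply hu | apply hw].
  - apply ex_derive_ext with (fun s => Derive u s - Derive w s).
    + intros s. symmetry. apply hD.
    + apply (ex_derive_minus (Derive u) (Derive w)); [apply hu | apply hw].
  - exact hmax.
  - rewrite hD in h1. rewrite (Derive_ext _ _ t hD) in h2.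
    rewrite Derive_minus in h2 by (apply hu || apply hw). lra.
Qed.

(** * Periodic functions *)

Lemma periodic_IZR (T : R) (f : R -> R) :
  periodic T f -> forall (k : Z) (t : R), f (t + IZR k * T) = f t.
Proof.
  intros hf.
  assert (hnat : forall (n : nat) t, f (t + INR n * T) = f t).
  { induction n as [ | n IH]; intros t.
    - simpl. now rewrite Rmult_0_l, Rplus_0_r.
    - rewrite S_INR, <- (IH t), <- (hf (t + INR n * T)). f_equal. ring. }
  intros k t. destruct k as [ | p | p].
  - now rewrite Rmult_0_l, Rplus_0_r.
  - rewrite <- (positive_nat_Z p), <- INR_IZR_INZ. apply hnat.
  - rewrite <- Pos2Z.opp_pos, opp_IZR, <- (positive_nat_Z p), <- INR_IZR_INZ.
    rewrite <- (hnat (Pos.to_nat p)). f_equal. ring.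
Qed.

Lemma periodic_representative (T t : R) :
  0 < T ->
  exists s, 0 <= s <= T /\ forall f, periodic T f -> f t = f s.
Proof.
  intros hT. destruct (archimed (t / T)) as [h1 h2].
  exists (t + IZR (1 - up (t / T)) * T). split.
  - rewrite minus_IZR.
    assert (ht : t = t / T * T) by (field; lra).
    set (q := t / T) in *. rewrite ht. nra.
  - intros f hf. now rewrite periodic_IZR.
Qed.

Lemma periodic_attains_max (T : R) (f : R -> R) :
  0 < T -> periodic T f -> (forall t, continuous f t) ->
  exists t, forall s, f s <= f t.
Proof.
  intros hT hf hc.
  destruct (continuity_ab_maj f 0 T) as [t [ht _]]; [lra | | ].
  - intros c _. apply continuity_pt_filterlim. apply hc.
  - exists t. intros s. destruct (periodic_representative T s hT) as [r [hr heq]].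
    rewrite (heq f hf). now apply ht.
Qed.

Lemma periodic_bounded (T : R) (f : R -> R) :
  0 < T -> periodic T f -> (forall t, continuous f t) ->
  exists B, forall t, Rabs (f t) <= B.
Proof.
  intros hT hf hc.
  destruct (periodic_attains_max T (fun t => Rabs (f t)) hT) as [t ht].
  - intros t. now rewrite hf.
  - intros t. apply (continuous_comp f Rabs); [apply hc | apply continuous_Rabs].
  - now exists (Rabs (f t)).
Qed.

Lemma periodic_Derive (T : R) (f : R -> R) :
  periodic T f -> periodic T (Derive f).
Proof.
  intros hf t. unfold Derive. f_equal. apply Lim_ext. intros h.
  rewrite hf. now replace (t + T + h) with (t + h + T) by ring; rewrite hf.
Qed.

(** Around each point of the box choose a radius within which [f] varies by at
    most [1], and so small that a large value at the point forces a small radius.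
    Compactness bounds these radii below, hence the values above. *)
Lemma box_bounded (T X Y : R) (f : R -> R -> R -> R) :
  0 < T -> jointly_continuous f -> periodic_in_t T f ->
  exists B, forall t x y, Rabs x <= X -> Rabs y <= Y -> Rabs (f t x y) <= B.
Proof.
  intros hT hc hper.
  assert (hrad : forall p : R * (R * (R * unit)), {d : posreal |
    d * (Rabs (f (fst p) (fst (snd p)) (fst (snd (snd p)))) + 1) <= 1 /\
    forall q, close_n 3 d q p ->
      Rabs (f (fst q) (fst (snd q)) (fst (snd (snd q)))) <=
      Rabs (f (fst p) (fst (snd p)) (fst (snd (snd p)))) + 1}).
  { intros [t [x [y []]]]. apply constructive_indefinite_description. simpl.
    destruct (proj1 (filterlim_locally _ _) (hc (t, x, y)) (mkposreal 1 Rlt_0_1)) as [e he].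
    assert (hA := Rabs_pos (f t x y)).
    set (A := Rabs (f t x y)) in *.
    assert (hi : 0 < / (A + 1)) by (apply Rinv_0_lt_compat; lra).
    assert (hm : 0 < Rmin e (/ (A + 1))).
    { apply Rmin_glb_lt; [apply cond_pos | exact hi]. }
    exists (mkposreal _ hm). simpl. split.
    - apply Rle_trans with (/ (A + 1) * (A + 1)).
      + apply Rmult_le_compat_r; [lra | apply Rmin_r].
      + rewrite Rinv_l; lra.
    - intros [t' [x' [y' []]]] [h1 [h2 [h3 _]]]. simpl.
      assert (hle := Rmin_l e (/ (A + 1))).
      assert (hb : ball (t, x, y) e (t', x', y')).
      { split; [split | ]; simpl.
        - change (Rabs (t' - t) < e). lra.
        - change (Rabs (x' - x) < e). lra.
        - change (Rabs (y' - y) < e). lra. }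
      apply he in hb. change (Rabs (f t' x' y' - f t x y) < 1) in hb.
      assert (htr := Rabs_triang (f t' x' y' - f t x y) (f t x y)).
      replace (f t' x' y' - f t x y + f t x y) with (f t' x' y') in htr by ring.
      fold A in htr. lra. }
  destruct (compactness_value 3 (0, (- X, (- Y, tt))) (T, (X, (Y, tt)))
    (fun p => proj1_sig (hrad p))) as [d hd].
  exists (/ d + 1). intros t x y hx hy.
  destruct (periodic_representative T t hT) as [s [hs heq]].
  rewrite (heq (fun r => f r x y)) by (intros r; apply hper).
  apply Rnot_lt_le. intros hbig.
  apply (hd (s, (x, (y, tt)))).
  { apply Rabs_le_between in hx. apply Rabs_le_between in hy.
    simpl. repeat split; lra. }
  intros [p [_ [hclose hdp]]].
  destruct (hrad p) as [e [hval hnear]].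
  simpl proj1_sig in hclose, hdp.
  specialize (hnear _ hclose).
  set (A := Rabs (f (fst p) _ _)) in *.
  assert (hA : 0 <= A) by apply Rabs_pos.
  assert (hdpos := cond_pos d).
  assert (hAd : A <= / d).
  { apply Rmult_le_reg_l with d; [lra | ]. rewrite Rinv_r by lra. nra. }
  simpl in hnear. lra.
Qed.

(** * Periodic solutions of linear equations *)

(** Variation of constants for [y' = c y + g], integrated over one period. *)
Definition periodic_linear (T c : R) (g : R -> R) (t : R) : R :=
  exp (c * t) / (exp (- c * T) - 1) *
  (RInt (fun s => exp (- c * s) * g s) 0 (t + T) -
   RInt (fun s => exp (- c * s) * g s) 0 t).

Lemma is_derive_RInt_continuous (f : R -> R) (t : R) :
  (forall s, continuous f s) -> is_derive (fun r => RInt f 0 r) t (f t).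
Proof.
  intros hf. apply (is_derive_RInt f (fun r => RInt f 0 r) 0 t); [ | apply hf].
  apply filter_forall. intros r.
  apply (RInt_correct f 0 r), (ex_RInt_continuous f). intros z _. apply hf.
Qed.

Lemma continuous_exp_mult (c : R) (g : R -> R) (t : R) :
  continuous g t -> continuous (fun s => exp (c * s) * g s) t.
Proof.
  intros hg. apply (continuous_mult (fun s => exp (c * s)) g); [ | exact hg].
  apply continuous_of_ex_derive. auto_derive. exact I.
Qed.

Lemma exp_minus_1_neq0 (x : R) : x <> 0 -> exp x - 1 <> 0.
Proof. intros hx h. apply hx, exp_inv. rewrite exp_0. lra. Qed.

Lemma periodic_linear_derive (T c : R) (g : R -> R) (t : R) :
  0 < T -> c <> 0 -> periodic T g -> (forall s, continuous g s) ->
  is_derive (periodic_linear T c g) t (c * periodic_linear T c g t + g t).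
Proof.
  intros hT hc hg hcont.
  assert (hne := exp_minus_1_neq0 (- c * T) ltac:(nra)).
  set (G := fun r => RInt (fun s => exp (- c * s) * g s) 0 r).
  assert (hG : forall r, is_derive G r (exp (- c * r) * g r)).
  { intros r.
    apply (is_derive_RInt_continuous (fun s => exp (- c * s) * g s)).
    intros s. now apply continuous_exp_mult. }
  apply (is_derive_ext (fun r => exp (c * r) / (exp (- c * T) - 1) * (G (r + T) - G r))).
  { reflexivity. }
  unfold periodic_linear. fold (G (t + T)) (G t).
  auto_derive.
  - split; [eexists; apply hG | split; [eexists; apply hG | exact I]].
  - rewrite (is_derive_unique (fun x : R => G x) _ _ (hG (t + T))), (is_derive_unique (fun x : R => G x) _ _ (hG t)).
    rewrite hg.
    replace (- c * (t + T)) with (- (c * t) + - c * T) by ring.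
    replace (- c * t) with (- (c * t)) by ring.
    rewrite exp_plus, exp_Ropp.
    assert (h := exp_pos (c * t)). field. split; lra.
Qed.

(** The integral over one period, as a function of its left end, is multiplied
    by [exp (- c T)] when that end moves by [T]: the difference below has zero
    derivative. *)
Lemma periodic_linear_periodic (T c : R) (g : R -> R) :
  periodic T g -> (forall s, continuous g s) -> periodic T (periodic_linear T c g).
Proof.
  intros hg hcont t.
  set (G := fun r => RInt (fun s => exp (- c * s) * g s) 0 r).
  assert (hG : forall r, is_derive G r (exp (- c * r) * g r)).
  { intros r.
    apply (is_derive_RInt_continuous (fun s => exp (- c * s) * g s)).
    intros s. now apply continuous_exp_mult. }
  assert (hconst : forall r, G (r + T) - exp (- c * T) * G r = G (0 + T) - exp (- c * T) * G 0).
  { intros r.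
    set (H := fun r => G (r + T) - exp (- c * T) * G r).
    assert (hd : forall s, is_derive H s 0).
    { intros s. unfold H. auto_derive.
      - split; [eexists; apply hG | split; [eexists; apply hG | exact I]].
      - rewrite (is_derive_unique (fun x : R => G x) _ _ (hG (s + T))), (is_derive_unique (fun x : R => G x) _ _ (hG s)).
        rewrite hg.
        replace (- c * (s + T)) with (- c * s + - c * T) by ring.
        rewrite exp_plus. ring. }
    destruct (MVT_gen H 0 r (fun _ => 0))
      as [z [_ hz]].
    - intros s _. apply hd.
    - intros s _. apply continuity_pt_filterlim.
      apply continuous_of_ex_derive. exists 0. apply hd.
    - fold (H r) (H 0). lra. }
  unfold periodic_linear. fold (G (t + T + T)) (G (t + T)) (G t).
  assert (h1 := hconst (t + T)). assert (h2 := hconst t).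
  replace (G (t + T + T) - G (t + T)) with (exp (- c * T) * (G (t + T) - G t)) by lra.
  replace (c * (t + T)) with (c * t + c * T) by ring.
  replace (- c * T) with (- (c * T)) by ring.
  rewrite exp_plus, exp_Ropp.
  assert (h := exp_pos (c * T)).
  unfold Rdiv. set (k := / (/ exp (c * T) - 1)). field. lra.
Qed.

(** The factorisation [D^2 - lam^2 = (D + lam) (D - lam)]. *)
Lemma second_order_periodic (T lam : R) (g : R -> R) :
  0 < T -> 0 < lam -> periodic T g -> (forall s, continuous g s) ->
  let u := periodic_linear T (- lam) (periodic_linear T lam g) in
  periodic T u /\
  forall t, ex_derive u t /\ is_derive (Derive u) t (lam ^ 2 * u t + g t).
Proof.
  intros hT hlam hg hcont. set (p := periodic_linear T lam g). intros u.
  assert (hp : forall t, is_derive p t (lam * p t + g t)).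
  { intros t. apply periodic_linear_derive; auto. lra. }
  assert (hpper : periodic T p) by now apply periodic_linear_periodic.
  assert (hpc : forall s, continuous p s).
  { intros s. apply continuous_of_ex_derive. eexists. apply hp. }
  assert (hu : forall t, is_derive u t (- lam * u t + p t)).
  { intros t. apply periodic_linear_derive; auto. lra. }
  split; [now apply periodic_linear_periodic | ].
  intros t. split; [eexists; apply hu | ].
  apply (is_derive_ext (fun s => - lam * u s + p s)).
  { intros s. symmetry. apply is_derive_unique, hu. }
  auto_derive.
  - split; [eexists; apply hu | split; [eexists; apply hp | exact I]].
  - rewrite (is_derive_unique (fun x : R => u x) _ _ (hu t)), (is_derive_unique (fun x : R => p x) _ _ (hp t)). ring.
Qed.

(** The function [exp (- c t) p t] decreases, and over one period it is
    multiplied by [exp (- c T)], whose position relative to [1] depends on the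
    sign of [c]. *)
Lemma periodic_linear_sign (T c : R) (p h : R -> R) :
  0 < T -> periodic T p ->
  (forall t, is_derive p t (c * p t - h t)) -> (forall t, 0 <= h t) ->
  forall t, 0 <= c * p t.
Proof.
  intros hT hp hd hh t.
  assert (hdec : exp (- c * (t + T)) * p (t + T) <= exp (- c * t) * p t).
  { apply (decreasing_of_derive_le0 (fun s => exp (- c * s) * p s)
      (fun s => - exp (- c * s) * h s)); [lra | | ].
    - intros s _. auto_derive.
      + eexists. apply hd.
      + rewrite (is_derive_unique (fun x : R => p x) _ _ (hd s)). ring.
    - intros s _. assert (h1 := exp_pos (- c * s)). assert (h2 := hh s). nra. }
  rewrite hp in hdec.
  replace (- c * (t + T)) with (- c * t + - c * T) in hdec by ring.
  rewrite exp_plus in hdec.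
  assert (hpos := exp_pos (- c * t)).
  assert (hle : p t * (exp (- c * T) - 1) <= 0).
  { apply Rmult_le_reg_l with (exp (- c * t)); [exact hpos | nra]. }
  destruct (Rtotal_order c 0) as [hc | [-> | hc]].
  - assert (h1 : 1 < exp (- c * T)) by (rewrite <- exp_0; apply exp_increasing; nra).
    nra.
  - lra.
  - assert (h1 : exp (- c * T) < 1) by (rewrite <- exp_0; apply exp_increasing; nra).
    nra.
Qed.

(** A quantitative maximum principle. Applied to the two first-order factors of
    [D^2 - lam^2], the sign lemma gives the signs of [w' + lam w] and of
    [w' - lam w]; this is what allows a term in [w'] to be absorbed by [w]. *)
Lemma periodic_derivative_control (T lam : R) (w : R -> R) :
  0 < T -> 0 < lam -> periodic T w ->
  (forall t, ex_derive w t /\ ex_derive (Derive w) t) ->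
  (forall t, Derive (Derive w) t <= lam ^ 2 * w t) ->
  forall t, Rabs (Derive w t) <= lam * w t.
Proof.
  intros hT hlam hw hd hsup t.
  assert (hw' := periodic_Derive T w hw).
  assert (h1 : 0 <= lam * (Derive w t + lam * w t)).
  { apply (periodic_linear_sign T lam (fun s => Derive w s + lam * w s)
      (fun s => lam ^ 2 * w s - Derive (Derive w) s)).
    - exact hT.
    - intros s. now rewrite hw, hw'.
    - intros s. auto_derive.
      + split; [apply hd | split; [apply hd | exact I]].
      + change (fun x : R => Derive w x) with (Derive w).
        change (fun x : R => w x) with w. ring.
    - intros s. specialize (hsup s). lra. }
  assert (h2 : 0 <= - lam * (Derive w t - lam * w t)).
  { apply (periodic_linear_sign T (- lam) (fun s => Derive w s - lam * w s)
      (fun s => lam ^ 2 * w s - Derive (Derive w) s)).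
    - exact hT.
    - intros s. now rewrite hw, hw'.
    - intros s. auto_derive.
      + split; [apply hd | split; [apply hd | exact I]].
      + change (fun x : R => Derive w x) with (Derive w).
        change (fun x : R => w x) with w. ring.
    - intros s. specialize (hsup s). lra. }
  apply Rabs_le. split; nra.
Qed.

(** * Differentiating a pointwise limit *)

(** The mean value theorem puts the difference quotients of [f n] at [t] within
    [eps] of [l], uniformly in [n], and such an estimate survives a pointwise
    limit. *)
Lemma is_derive_pointwise_limit (f f' : nat -> R -> R) (phi : R -> R) (t l : R) :
  (forall n s, is_derive (f n) s (f' n s)) ->
  (forall s, is_lim_seq (fun n => f n s) (phi s)) ->
  (forall eps, 0 < eps -> exists d N, 0 < d /\
     forall n s, (N <= n)%nat -> Rabs (s - t) < d -> Rabs (f' n s - l) <= eps) ->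
  is_derive phi t l.
Proof.
  intros hf hphi hl. apply is_derive_Reals. intros eps heps.
  destruct (hl (eps / 2) ltac:(lra)) as [d [N [hd hN]]].
  exists (mkposreal d hd). intros h hh hhd. simpl in hhd.
  assert (hinc : forall n, (N <= n)%nat ->
    Rabs (f n (t + h) - f n t - l * h) <= eps / 2 * Rabs h).
  { intros n hn.
    replace (f n (t + h) - f n t - l * h)
      with ((f n (t + h) - l * (t + h)) - (f n t - l * t)) by ring.
    replace h with (t + h - t) at 3 by ring.
    apply (mean_value_abs (fun s => f n s - l * s) (fun s => f' n s - l)).
    - intros s _. auto_derive; [eexists; apply hf | ].
      rewrite (is_derive_unique (fun x : R => f n x) _ _ (hf n s)). ring.
    - intros s hs. apply hN; [exact hn | ].
      apply Rabs_def2 in hhd. unfold Rmin, Rmax in hs.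
      destruct (Rle_dec t (t + h)); apply Rabs_def1; lra. }
  assert (hlim : Rabs (phi (t + h) - phi t - l * h) <= eps / 2 * Rabs h).
  { assert (hseq : is_lim_seq (fun n => Rabs (f n (t + h) - f n t - l * h))
      (Rabs (phi (t + h) - phi t - l * h))).
    { apply (is_lim_seq_abs _ (Finite _)).
      apply is_lim_seq_minus'; [apply is_lim_seq_minus'; apply hphi | apply is_lim_seq_const]. }
    apply (is_lim_seq_le_loc _ (fun _ => eps / 2 * Rabs h) _ (Finite (eps / 2 * Rabs h)))
      in hseq; [exact hseq | | apply is_lim_seq_const].
    exists N. exact hinc. }
  replace ((phi (t + h) - phi t) / h - l) with ((phi (t + h) - phi t - l * h) / h)
    by (field; exact hh).
  unfold Rdiv. rewrite Rabs_mult, Rabs_inv.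
  assert (hpos := Rabs_pos_lt h hh).
  apply Rle_lt_trans with (eps / 2 * Rabs h * / Rabs h).
  - apply Rmult_le_compat_r; [ | exact hlim].
    left. now apply Rinv_0_lt_compat.
  - rewrite Rmult_assoc, Rinv_r by lra. lra.
Qed.

Lemma equilipschitz_locally_uniform (f : nat -> R -> R) (L t l : R) :
  (forall n s, Rabs (f n s - f n t) <= L * Rabs (s - t)) ->
  is_lim_seq (fun n => f n t) l ->
  forall eps, 0 < eps -> exists d N, 0 < d /\
    forall n s, (N <= n)%nat -> Rabs (s - t) < d -> Rabs (f n s - l) <= eps.
Proof.
  intros hL hl eps heps.
  assert (hhalf : 0 < eps / 2) by lra.
  apply is_lim_seq_spec in hl. destruct (hl (mkposreal _ hhalf)) as [N hN]. simpl in hN.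
  assert (hLpos : 0 < Rabs L + 1) by (assert (h := Rabs_pos L); lra).
  exists (eps / 2 / (Rabs L + 1)), N. split; [now apply Rdiv_lt_0_compat | ].
  intros n s hn hs. specialize (hN n hn). specialize (hL n s).
  assert (hsmall : L * Rabs (s - t) <= eps / 2).
  { apply Rle_trans with ((Rabs L + 1) * (eps / 2 / (Rabs L + 1))).
    - assert (h1 := Rle_abs L). assert (h2 := Rabs_pos (s - t)).
      apply Rle_trans with ((Rabs L + 1) * Rabs (s - t)); [nra | ].
      apply Rmult_le_compat_l; lra.
    - right. field. lra. }
  replace (f n s - l) with ((f n s - f n t) + (f n t - l)) by ring.
  eapply Rle_trans; [apply Rabs_triang | ]. lra.
Qed.

(** * Monotone iteration *)

Definition lipschitz_in_state (K : R) (F : R -> R -> R -> R) : Prop :=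
  forall t x y x' y',
    Rabs (F t x y - F t x' y') <= K * (Rabs (x - x') + Rabs (y - y')).

Definition lower_solution (T : R) (F : R -> R -> R -> R) (u : R -> R) : Prop :=
  periodic T u /\
  forall t, ex_derive u t /\ ex_derive (Derive u) t /\
            F t (u t) (Derive u t) <= Derive (Derive u) t.

(** The periodic solution [y] of [y'' - lam^2 y = F(t, u, u') - lam^2 u]. *)
Definition iterate_step (T lam : R) (F : R -> R -> R -> R) (u : R -> R) : R -> R :=
  periodic_linear T (- lam) (periodic_linear T lam
    (fun t => F t (u t) (Derive u t) - lam ^ 2 * u t)).

Lemma continuous_along (K : R) (F : R -> R -> R -> R) (f g : R -> R) (t : R) :
  0 <= K -> lipschitz_in_state K F -> (forall x y, continuous (fun s => F s x y) t) ->
  continuous f t -> continuous g t -> continuous (fun s => F s (f s) (g s)) t.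
Proof.
  intros hK hlip hF hf hg. apply filterlim_locally. intros eps.
  assert (he : 0 < eps / (1 + 2 * K)).
  { apply Rdiv_lt_0_compat; [apply cond_pos | lra]. }
  set (e := mkposreal _ he).
  assert (h1 := proj1 (filterlim_locally _ _) (hF (f t) (g t)) e).
  assert (h2 := proj1 (filterlim_locally _ _) hf e).
  assert (h3 := proj1 (filterlim_locally _ _) hg e).
  generalize (filter_and _ _ h1 (filter_and _ _ h2 h3)). apply filter_imp.
  intros s [b1 [b2 b3]].
  change (Rabs (F s (f t) (g t) - F t (f t) (g t)) < e) in b1.
  change (Rabs (f s - f t) < e) in b2. change (Rabs (g s - g t) < e) in b3.
  change (Rabs (F s (f s) (g s) - F t (f t) (g t)) < eps).
  replace (F s (f s) (g s) - F t (f t) (g t)) with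
    ((F s (f s) (g s) - F s (f t) (g t)) + (F s (f t) (g t) - F t (f t) (g t))) by ring.
  eapply Rle_lt_trans; [apply Rabs_triang | ].
  assert (h4 := hlip s (f s) (g s) (f t) (g t)).
  replace (pos eps) with (e + K * (2 * e)) by (simpl; field; lra).
  apply Rle_lt_trans with
    (K * (Rabs (f s - f t) + Rabs (g s - g t)) + Rabs (F s (f t) (g t) - F t (f t) (g t)));
    [lra | nra].
Qed.

Lemma iterate_step_spec (T K lam : R) (F : R -> R -> R -> R) (u : R -> R) :
  0 < T -> 0 <= K -> 0 < lam -> lipschitz_in_state K F -> periodic_in_t T F ->
  (forall x y t, continuous (fun s => F s x y) t) ->
  periodic T u -> (forall t, ex_derive u t /\ ex_derive (Derive u) t) ->
  periodic T (iterate_step T lam F u) /\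
  forall t, ex_derive (iterate_step T lam F u) t /\
    is_derive (Derive (iterate_step T lam F u)) t
      (F t (u t) (Derive u t) + lam ^ 2 * (iterate_step T lam F u t - u t)).
Proof.
  intros hT hK hlam hlip hper hcont hu hd.
  destruct (second_order_periodic T lam (fun t => F t (u t) (Derive u t) - lam ^ 2 * u t)
    hT hlam) as [h1 h2].
  - intros t. rewrite (periodic_Derive T u hu t), hu. now rewrite hper.
  - intros t.
    apply (continuous_minus (fun t => F t (u t) (Derive u t)) (fun t => lam ^ 2 * u t)).
    + apply (continuous_along K); auto; apply continuous_of_ex_derive; apply hd.
    + apply (continuous_scal_r (lam ^ 2) u). apply continuous_of_ex_derive, hd.
  - split; [exact h1 | ]. intros t. destruct (h2 t) as [h3 h4]. split; [exact h3 | ].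
    unfold iterate_step.
    match goal with |- is_derive _ _ ?l => replace l with
      (lam ^ 2 * periodic_linear T (- lam) (periodic_linear T lam
         (fun t => F t (u t) (Derive u t) - lam ^ 2 * u t)) t
       + (F t (u t) (Derive u t) - lam ^ 2 * u t)) by ring end.
    exact h4.
Qed.

(** The increment [w] satisfies [w'' - lam^2 w = F(u) - u'' <= 0], hence
    [|w'| <= lam w]. The error [F(u + w) - F(u)], at most [K (w + |w'|)], is then
    at most [K (1 + lam) w <= lam^2 w], so that the new function is again a lower
    solution. *)
Lemma iterate_step_lower (T K : R) (F : R -> R -> R -> R) (u : R -> R) :
  0 < T -> 0 <= K -> lipschitz_in_state K F -> periodic_in_t T F ->
  (forall x y t, continuous (fun s => F s x y) t) ->
  lower_solution T F u ->
  let v := iterate_step T (K + 1) F u in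
  lower_solution T F v /\
  forall t, Rabs (Derive v t - Derive u t) <= (K + 1) * (v t - u t).
Proof.
  intros hT hK hlip hper hcont [hu hlow] v.
  destruct (iterate_step_spec T K (K + 1) F u) as [hv hv2]; auto; try lra.
  { intros t. split; apply hlow. }
  fold v in hv, hv2.
  assert (hD : forall t, Derive (fun s => v s - u s) t = Derive v t - Derive u t).
  { intros t. apply Derive_minus; [apply hv2 | apply hlow]. }
  assert (hctrl : forall t, Rabs (Derive v t - Derive u t) <= (K + 1) * (v t - u t)).
  { intros t. rewrite <- hD.
    apply (periodic_derivative_control T (K + 1) (fun s => v s - u s)); [exact hT | lra | | | ].
    - intros s. now rewrite hv, hu.
    - intros s. split.
      + apply (ex_derive_minus v u); [apply hv2 | apply hlow].
      + apply ex_derive_ext with (fun r => Derive v r - Derive u r).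
        { intros r. symmetry. apply hD. }
        apply (ex_derive_minus (Derive v) (Derive u)); [eexists; apply hv2 | apply hlow].
    - intros s. rewrite (Derive_ext _ _ s hD).
      rewrite Derive_minus; [ | eexists; apply hv2 | apply hlow].
      rewrite (is_derive_unique _ _ _ (proj2 (hv2 s))).
      destruct (hlow s) as [_ [_ h]]. lra. }
  split; [ | exact hctrl]. split; [exact hv | ].
  intros t. split; [apply hv2 | split; [eexists; apply hv2 | ]].
  rewrite (is_derive_unique _ _ _ (proj2 (hv2 t))).
  assert (h1 := hlip t (v t) (Derive v t) (u t) (Derive u t)).
  assert (h2 := hctrl t).
  assert (h3 : 0 <= v t - u t).
  { assert (h := Rabs_pos (Derive v t - Derive u t)). nra. }
  rewrite (Rabs_pos_eq (v t - u t)) in h1 by exact h3.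
  apply Rabs_le_between in h1.
  assert (h4 : K * (v t - u t + Rabs (Derive v t - Derive u t)) <=
               (K + 1) ^ 2 * (v t - u t)).
  { apply Rle_trans with (K * (v t - u t + (K + 1) * (v t - u t))); [ | nra].
    apply Rmult_le_compat_l; lra. }
  lra.
Qed.

(** The iterates increase, and as lower solutions they stay below [B]. Because
    of [|w'| <= lam w] for their increments, their first and second derivatives are
    bounded uniformly and their first derivatives converge pointwise, so that
    both [u n] and [u n '] can be differentiated in the limit. *)
Lemma solution_above_lower_solution (T K B : R) (F : R -> R -> R -> R) (u0 : R -> R) :
  0 < T -> 0 <= K -> lipschitz_in_state K F -> periodic_in_t T F ->
  (forall x y t, continuous (fun s => F s x y) t) ->
  (forall t x y, Rabs (F t x y) <= B) ->
  lower_solution T F u0 ->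
  (forall t, Rabs (u0 t) <= B) -> (forall t, Rabs (Derive u0 t) <= B) ->
  (forall u, lower_solution T F u -> forall t, u t <= B) ->
  exists x, is_solution F x /\ periodic T x /\ forall t, u0 t <= x t.
Proof.
  intros hT hK hlip hper hcont hFB hu0 hB0 hB0' hup.
  set (lam := K + 1). assert (hlam : 0 < lam) by (unfold lam; lra).
  set (u := fun n => Nat.iter n (iterate_step T lam F) u0).
  assert (hlow : forall n, lower_solution T F (u n)).
  { induction n as [ | n IH]; [exact hu0 | ].
    now apply (iterate_step_lower T K F (u n)). }
  assert (hstep : forall n t,
    Rabs (Derive (u (S n)) t - Derive (u n) t) <= lam * (u (S n) t - u n t)).
  { intros n. now apply (iterate_step_lower T K F (u n)). }
  assert (hd2 : forall n t, is_derive (Derive (u (S n))) t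
    (F t (u n t) (Derive (u n) t) + lam ^ 2 * (u (S n) t - u n t))).
  { intros n t. apply (iterate_step_spec T K lam F (u n)); auto.
    - exact (proj1 (hlow n)).
    - intros s. destruct (proj2 (hlow n) s) as [h1 [h2 _]]. now split. }
  assert (hd1 : forall n t, is_derive (u n) t (Derive (u n) t)).
  { intros n t. apply Derive_correct. exact (proj1 (proj2 (hlow n) t)). }
  assert (hzero : u 0%nat = u0) by reflexivity.
  clearbody u.
  assert (hincr : forall n t, u n t <= u (S n) t).
  { intros n t. specialize (hstep n t).
    assert (h := Rabs_pos (Derive (u (S n)) t - Derive (u n) t)). nra. }
  assert (hge : forall n t, u0 t <= u n t).
  { induction n as [ | n IH]; intros t; [rewrite hzero; apply Rle_refl | ].
    eapply Rle_trans; [apply IH | apply hincr]. }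
  assert (hle : forall n t, u n t <= B) by (intros n; apply hup, hlow).
  assert (hbd : forall n t, Rabs (u n t) <= B).
  { intros n t. assert (h1 := hge n t). assert (h2 := hle n t). assert (h3 := hB0 t).
    apply Rabs_le_between in h3. apply Rabs_le. lra. }
  assert (hfar : forall n t, Rabs (Derive (u n) t - Derive u0 t) <= lam * (u n t - u0 t)).
  { induction n as [ | n IH]; intros t.
    - rewrite hzero, !Rminus_diag, Rabs_R0. lra.
    - replace (Derive (u (S n)) t - Derive u0 t) with
        ((Derive (u (S n)) t - Derive (u n) t) + (Derive (u n) t - Derive u0 t)) by ring.
      eapply Rle_trans; [apply Rabs_triang | ].
      specialize (IH t). specialize (hstep n t). lra. }
  set (B1 := B + lam * (2 * B)).
  assert (hbd1 : forall n t, Rabs (Derive (u n) t) <= B1).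
  { intros n t. replace (Derive (u n) t) with
      (Derive u0 t + (Derive (u n) t - Derive u0 t)) by ring.
    eapply Rle_trans; [apply Rabs_triang | ].
    assert (h1 := hfar n t). assert (h2 := hB0' t). assert (h3 := hB0 t).
    assert (h4 := hle n t). apply Rabs_le_between in h3. unfold B1. nra. }
  set (B2 := B + lam ^ 2 * (2 * B)).
  assert (hbd2 : forall n t,
    Rabs (F t (u n t) (Derive (u n) t) + lam ^ 2 * (u (S n) t - u n t)) <= B2).
  { intros n t. eapply Rle_trans; [apply Rabs_triang | ].
    assert (h1 := hFB t (u n t) (Derive (u n) t)). rewrite Rabs_mult.
    rewrite (Rabs_pos_eq (lam ^ 2)) by (apply pow2_ge_0).
    assert (h2 := hbd n t). assert (h3 := hle (S n) t). assert (h4 := hincr n t).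
    rewrite (Rabs_pos_eq (u (S n) t - u n t)) by lra.
    apply Rabs_le_between in h2. assert (h5 := pow2_ge_0 lam). unfold B2. nra. }
  assert (hlip1 : forall n s t, Rabs (u n s - u n t) <= B1 * Rabs (s - t)).
  { intros n s t. apply (mean_value_abs (u n) (Derive (u n))); intros r _.
    - apply hd1.
    - apply hbd1. }
  assert (hlip2 : forall n s t,
    Rabs (Derive (u (S n)) s - Derive (u (S n)) t) <= B2 * Rabs (s - t)).
  { intros n s t. apply (mean_value_abs (Derive (u (S n))) (fun r =>
      F r (u n r) (Derive (u n) r) + lam ^ 2 * (u (S n) r - u n r))); intros r _.
    - apply hd2.
    - apply hbd2. }
  assert (hconv : forall t, ex_finite_lim_seq (fun n => u n t)).
  { intros t. apply (ex_finite_lim_seq_incr _ B); intros n; [apply hincr | apply hle]. }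
  (* [u n' + lam u n] increases with [n] and is bounded. *)
  assert (hconv1 : forall t, ex_finite_lim_seq (fun n => Derive (u n) t)).
  { intros t. destruct (hconv t) as [l hl].
    destruct (ex_finite_lim_seq_incr (fun n => Derive (u n) t + lam * u n t) (B1 + lam * B))
      as [m hm].
    - intros n. assert (h := hstep n t). apply Rabs_le_between in h. lra.
    - intros n. assert (h := hbd1 n t). apply Rabs_le_between in h.
      assert (h1 := hle n t). nra.
    - exists (m - lam * l).
      apply is_lim_seq_ext with (fun n => (Derive (u n) t + lam * u n t) - lam * u n t).
      { intros n. ring. }
      apply is_lim_seq_minus'; [exact hm | ].
      apply (is_lim_seq_scal_l _ lam (Finite l)). exact hl. }
  set (phi := fun t => real (Lim_seq (fun n => u n t))).
  set (psi := fun t => real (Lim_seq (fun n => Derive (u n) t))).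
  assert (hphi : forall t, is_lim_seq (fun n => u n t) (phi t)).
  { intros t. now apply Lim_seq_correct'. }
  assert (hpsi : forall t, is_lim_seq (fun n => Derive (u n) t) (psi t)).
  { intros t. now apply Lim_seq_correct'. }
  assert (hphi' : forall t, is_derive phi t (psi t)).
  { intros t.
    apply (is_derive_pointwise_limit (fun n => u (S n)) (fun n => Derive (u (S n)))).
    - intros n s. apply hd1.
    - intros s. apply (is_lim_seq_incr_1 (fun n => u n s)), hphi.
    - apply (equilipschitz_locally_uniform (fun n => Derive (u (S n))) B2).
      + intros n s. apply hlip2.
      + apply (is_lim_seq_incr_1 (fun n => Derive (u n) t)), hpsi. }
  assert (hpsi' : forall t, is_derive psi t (F t (phi t) (psi t))).
  { intros t.
    apply (is_derive_pointwise_limit (fun n => Derive (u (S (S n)))) (fun n s =>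
      F s (u (S n) s) (Derive (u (S n)) s) + lam ^ 2 * (u (S (S n)) s - u (S n) s))).
    - intros n s. apply hd2.
    - intros s. apply (is_lim_seq_incr_1 (fun n => Derive (u (S n)) s)).
      apply (is_lim_seq_incr_1 (fun n => Derive (u n) s)), hpsi.
    - intros eps heps.
      assert (hc : 0 < 1 + 2 * K + 2 * lam ^ 2) by (assert (h := pow2_ge_0 lam); lra).
      set (e := eps / (1 + 2 * K + 2 * lam ^ 2)).
      assert (he : 0 < e) by now apply Rdiv_lt_0_compat.
      destruct (equilipschitz_locally_uniform u B1 t (phi t) (fun n s => hlip1 n s t)
        (hphi t) e he) as [d1 [N1 [hd1' hN1]]].
      destruct (equilipschitz_locally_uniform (fun n => Derive (u (S n))) B2 t (psi t)
        (fun n s => hlip2 n s t)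
        (proj1 (is_lim_seq_incr_1 (fun n => Derive (u n) t) _) (hpsi t)) e he)
        as [d2 [N2 [hd2' hN2]]].
      destruct (proj1 (filterlim_locally _ _) (hcont (phi t) (psi t) t) (mkposreal e he))
        as [d3 hd3].
      exists (Rmin d1 (Rmin d2 d3)), (Nat.max N1 N2). split.
      { apply Rmin_glb_lt; [exact hd1' | apply Rmin_glb_lt; [exact hd2' | apply cond_pos]]. }
      intros n s hn hs.
      assert (hm1 := Rmin_l d1 (Rmin d2 d3)). assert (hm2 := Rmin_r d1 (Rmin d2 d3)).
      assert (hm3 := Rmin_l d2 d3). assert (hm4 := Rmin_r d2 d3).
      assert (hnN1 : (N1 <= n)%nat) by lia. assert (hnN2 : (N2 <= n)%nat) by lia.
      assert (a1 := hN1 (S n) s ltac:(lia) ltac:(lra)).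
      assert (a2 := hN1 (S (S n)) s ltac:(lia) ltac:(lra)).
      assert (a3 := hN2 n s hnN2 ltac:(lra)). simpl in a3.
      assert (a4 : Rabs (F s (phi t) (psi t) - F t (phi t) (psi t)) < e).
      { apply (hd3 s). change (Rabs (s - t) < d3). lra. }
      assert (a5 := hlip s (u (S n) s) (Derive (u (S n)) s) (phi t) (psi t)).
      replace (F s (u (S n) s) (Derive (u (S n)) s)
               + lam ^ 2 * (u (S (S n)) s - u (S n) s) - F t (phi t) (psi t)) with
        ((F s (u (S n) s) (Derive (u (S n)) s) - F s (phi t) (psi t)) +
         (F s (phi t) (psi t) - F t (phi t) (psi t)) +
         lam ^ 2 * ((u (S (S n)) s - phi t) - (u (S n) s - phi t))) by ring.
      assert (a6 : Rabs (lam ^ 2 * ((u (S (S n)) s - phi t) - (u (S n) s - phi t)))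
                   <= lam ^ 2 * (2 * e)).
      { rewrite Rabs_mult, (Rabs_pos_eq (lam ^ 2)) by apply pow2_ge_0.
        apply Rmult_le_compat_l; [apply pow2_ge_0 | ].
        eapply Rle_trans; [apply Rabs_triang | ]. rewrite Rabs_Ropp. lra. }
      eapply Rle_trans; [apply Rabs_triang | ].
      eapply Rle_trans; [apply Rplus_le_compat_r, Rabs_triang | ].
      replace eps with (K * (2 * e) + e + lam ^ 2 * (2 * e)) by (unfold e; field; lra).
      assert (a7 : K * (Rabs (u (S n) s - phi t) + Rabs (Derive (u (S n)) s - psi t))
                   <= K * (2 * e)) by (apply Rmult_le_compat_l; lra).
      lra. }
  assert (hDphi : forall t, Derive phi t = psi t).
  { intros t. apply is_derive_unique, hphi'. }
  exists phi. split; [ | split].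
  - intros t. split; [eexists; apply hphi' | ]. rewrite hDphi.
    apply (is_derive_ext psi); [intros s; symmetry; apply hDphi | apply hpsi'].
  - intros t. unfold phi. f_equal. apply Lim_seq_ext. intros n. apply hlow.
  - intros t.
    assert (h := is_lim_seq_le (fun _ => u0 t) (fun n => u n t) (u0 t) (phi t)
      (fun n => hge n t) (is_lim_seq_const _) (hphi t)).
    exact h.
Qed.

(** * Comparison and derivative bounds *)

(** If [u] reached [w], then at a maximum of [u - w] the functions would be
    tangent with [u] strictly more convex than [w], against [contact_order]. *)
Lemma strict_comparison (T : R) (u w : R -> R) :
  0 < T -> periodic T u -> periodic T w ->
  (forall t, ex_derive u t /\ ex_derive (Derive u) t) ->
  (forall t, ex_derive w t /\ ex_derive (Derive w) t) ->
  (forall t, w t <= u t -> Derive u t = Derive w t ->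
             Derive (Derive w) t < Derive (Derive u) t) ->
  forall t, u t < w t.
Proof.
  intros hT hu hw hdu hdw hconv t.
  destruct (periodic_attains_max T (fun s => u s - w s) hT) as [m hm].
  - intros s. now rewrite hu, hw.
  - intros s. apply (continuous_minus u w); apply continuous_of_ex_derive;
      [apply hdu | apply hdw].
  - apply Rnot_le_lt. intros hle.
    destruct (contact_order u w m hdu hdw hm) as [h1 h2].
    specialize (hm t). specialize (hconv m ltac:(lra) h1). lra.
Qed.

Lemma last_exit (f : R -> R) (a b l : R) :
  a <= b -> (forall t, continuous f t) -> f a <= l ->
  exists s, a <= s <= b /\ f s <= l /\ forall r, s < r <= b -> l < f r.
Proof.
  intros hab hf hfa.
  destruct (completeness (fun r => a <= r <= b /\ f r <= l)) as [s [hs1 hs2]].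
  - exists b. intros r hr. apply hr.
  - exists a. split; [lra | exact hfa].
  - assert (hsb : a <= s <= b).
    { split; [apply hs1; split; [lra | exact hfa] | apply hs2; intros r hr; apply hr]. }
    exists s. split; [exact hsb | split].
    + apply Rnot_lt_le. intros hlt.
      destruct (proj1 (filterlim_locally _ _) (hf s) (mkposreal (f s - l) ltac:(lra)))
        as [d hd].
      assert (hbelow : s <= s - d).
      { apply hs2. intros r [hr1 hr2]. apply Rnot_lt_le. intros hrd.
        assert (hrs : r <= s) by now apply hs1.
        assert (hb : ball s d r).
        { change (Rabs (r - s) < d). apply Rabs_def1; assert (h := cond_pos d); lra. }
        apply hd in hb. change (Rabs (f r - f s) < f s - l) in hb.
        apply Rabs_def2 in hb. lra. }
      assert (h := cond_pos d). lra.
    + intros r hr. apply Rnot_le_lt. intros hle.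
      assert (h : r <= s) by (apply hs1; split; [lra | exact hle]). lra.
Qed.

(** While [x' >= 1], the inequality [x'' <= C x'^2] says that
    [x' exp (- C x)] decreases. Since [x'] vanishes somewhere in every period,
    the last earlier time with [x' <= 1] bounds [x'] by the oscillation of [x]. *)
Lemma derivative_upper_bound (T C B : R) (x : R -> R) :
  0 < T -> 0 <= C -> periodic T x ->
  (forall t, ex_derive x t /\ ex_derive (Derive x) t) ->
  (forall t, Rabs (x t) <= B) ->
  (forall t, 1 <= Rabs (Derive x t) -> Derive (Derive x) t <= C * Derive x t ^ 2) ->
  forall t, Derive x t <= exp (2 * B * C).
Proof.
  intros hT hC hper hd hB hquad t.
  destruct (mean_value x (Derive x) (t - T) t) as [z [hz heq]]; [lra | | ].
  { intros c _. apply Derive_correct, hd. }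
  assert (hz0 : Derive x z = 0).
  { rewrite <- (hper (t - T)) in heq. replace (t - T + T) with t in heq by ring. nra. }
  destruct (last_exit (Derive x) z t 1) as [s [hs [hs1 hs2]]]; [lra | | lra | ].
  { intros r. apply continuous_of_ex_derive, hd. }
  assert (hdec : exp (- C * x t) * Derive x t <= exp (- C * x s) * Derive x s).
  { apply (decreasing_of_derive_le0 (fun r => exp (- C * x r) * Derive x r)
      (fun r => exp (- C * x r) * (Derive (Derive x) r - C * Derive x r ^ 2))); [lra | | ].
    - intros r _. auto_derive.
      + split; [apply hd | split; [apply hd | exact I]].
      + change (fun x0 : R => Derive x x0) with (Derive x).
        change (fun x0 : R => x x0) with x. ring.
    - intros r hr. assert (h1 := hs2 r ltac:(lra)).
      assert (h2 := hquad r ltac:(rewrite Rabs_pos_eq; lra)).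
      assert (h3 := exp_pos (- C * x r)). nra. }
  apply Rmult_le_reg_l with (exp (- C * x t)); [apply exp_pos | ].
  rewrite <- exp_plus.
  apply Rle_trans with (exp (- C * x s)).
  - assert (h := exp_pos (- C * x s)). nra.
  - assert (h1 := hB t). assert (h2 := hB s).
    apply Rabs_le_between in h1. apply Rabs_le_between in h2.
    assert (hexp : - C * x s <= - C * x t + 2 * B * C) by nra.
    destruct hexp as [hlt | heq']; [left; now apply exp_increasing | right; now f_equal].
Qed.

(** The quadratic condition is invariant under [t -> - t], which exchanges upper
    and lower bounds of [x']. *)
Lemma derivative_bound (T C B : R) (x : R -> R) :
  0 < T -> 0 <= C -> periodic T x ->
  (forall t, ex_derive x t /\ ex_derive (Derive x) t) ->
  (forall t, Rabs (x t) <= B) ->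
  (forall t, 1 <= Rabs (Derive x t) -> Derive (Derive x) t <= C * Derive x t ^ 2) ->
  forall t, Rabs (Derive x t) <= exp (2 * B * C).
Proof.
  intros hT hC hper hd hB hquad t.
  assert (hr1 : forall s, is_derive (fun r => x (- r)) s (- Derive x (- s))).
  { intros s. auto_derive; [apply hd | ].
    change (fun x0 : R => x x0) with x. ring. }
  assert (hD1 : forall s, Derive (fun r => x (- r)) s = - Derive x (- s)).
  { intros s. apply is_derive_unique, hr1. }
  assert (hr2 : forall s, is_derive (Derive (fun r => x (- r))) s (Derive (Derive x) (- s))).
  { intros s. apply (is_derive_ext (fun r => - Derive x (- r))).
    { intros r. symmetry. apply hD1. }
    auto_derive; [apply hd | ].
    change (fun x0 : R => Derive x x0) with (Derive x). ring. }
  apply Rabs_le. split.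
  - assert (h : Derive (fun r => x (- r)) (- t) <= exp (2 * B * C)).
    { apply (derivative_upper_bound T C B); auto.
      - intros s. rewrite <- (hper (- (s + T))). f_equal. ring.
      - intros s. split; [eexists; apply hr1 | eexists; apply hr2].
      - intros s. rewrite hD1, (is_derive_unique _ _ _ (hr2 s)), Rabs_Ropp.
        intros hs. specialize (hquad (- s) hs). lra. }
    rewrite hD1, Ropp_involutive in h. lra.
  - now apply (derivative_upper_bound T C B).
Qed.

(** * Truncation *)

Definition clamp (lo hi x : R) : R := Rmax lo (Rmin x hi).

Lemma clamp_id (lo hi x : R) : lo <= x <= hi -> clamp lo hi x = x.
Proof. intros h. unfold clamp. rewrite Rmin_left, Rmax_right; lra. Qed.

Lemma clamp_above (lo hi x : R) : lo <= hi <= x -> clamp lo hi x = hi.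
Proof. intros h. unfold clamp. rewrite Rmin_right, Rmax_right; lra. Qed.

Lemma clamp_below (lo hi x : R) : x <= lo <= hi -> clamp lo hi x = lo.
Proof. intros h. unfold clamp. rewrite Rmin_left, Rmax_left; lra. Qed.

Lemma clamp_bounds (lo hi x : R) : lo <= hi -> lo <= clamp lo hi x <= hi.
Proof.
  intros h. unfold clamp. split; [apply Rmax_l | apply Rmax_lub; [exact h | apply Rmin_r]].
Qed.

Lemma clamp_lipschitz (lo hi x y : R) :
  Rabs (clamp lo hi x - clamp lo hi y) <= Rabs (x - y).
Proof.
  unfold clamp, Rmax, Rmin. destruct (Rle_dec x hi), (Rle_dec y hi);
  repeat match goal with |- context [Rle_dec ?a ?b] => destruct (Rle_dec a b) end;
    unfold Rabs; repeat match goal with |- context [Rcase_abs ?a] => destruct (Rcase_abs a) end;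
    lra.
Qed.

Lemma continuous_clamp (lo hi : R -> R) (x t : R) :
  continuous lo t -> continuous hi t -> continuous (fun s => clamp (lo s) (hi s) x) t.
Proof.
  intros hlo hhi.
  assert (hmax : forall f g : R -> R, continuous f t -> continuous g t ->
    continuous (fun s => Rmax (f s) (g s)) t).
  { intros f g hf hg.
    apply continuous_ext with (fun s => / 2 * ((f s + g s) + Rabs (f s - g s))).
    - intros s. unfold Rmax, Rabs. destruct (Rle_dec (f s) (g s)), (Rcase_abs (f s - g s)); lra.
    - apply (continuous_scal_r (/ 2) (fun s => (f s + g s) + Rabs (f s - g s))).
      apply (continuous_plus (fun s => f s + g s) (fun s => Rabs (f s - g s))).
      + now apply (continuous_plus f g).
      + apply (continuous_comp (fun s => f s - g s) Rabs).
        * now apply (continuous_minus f g).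
        * apply continuous_Rabs. }
  apply hmax; [exact hlo | ].
  apply continuous_ext with (fun s => - Rmax (- x) (- hi s)).
  - intros s. unfold Rmax, Rmin. destruct (Rle_dec (- x) (- hi s)), (Rle_dec x (hi s)); lra.
  - apply (continuous_opp (fun s => Rmax (- x) (- hi s))), hmax.
    + apply continuous_const.
    + now apply (continuous_opp hi).
Qed.

Lemma jointly_continuous_along (v : R -> R -> R -> R) (f : R -> R) (y t : R) :
  jointly_continuous v -> continuous f t -> continuous (fun s => v s (f s) y) t.
Proof.
  intros hv hf.
  apply (continuous_comp (fun s => (s, f s, y))
    (fun q : R * R * R => v (fst (fst q)) (snd (fst q)) (snd q))); [ | apply hv].
  apply filterlim_locally. intros eps.
  generalize (filter_and _ _ (locally_ball t eps) (proj1 (filterlim_locally _ _) hf eps)).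
  apply filter_imp. intros s [h1 h2].
  split; [split; [exact h1 | exact h2] | apply ball_center].
Qed.

Lemma C1_lipschitz_on_box (T X Y : R) (v : R -> R -> R -> R) :
  0 < T -> C_n 1 v -> periodic_in_t T v ->
  exists K, 0 <= K /\ forall t x y x' y',
    Rabs x <= X -> Rabs x' <= X -> Rabs y <= Y -> Rabs y' <= Y ->
    Rabs (v t x y - v t x' y') <= K * (Rabs (x - x') + Rabs (y - y')).
Proof.
  intros hT [_ [hd [_ [[hc2 _] [hc3 _]]]]] hper.
  destruct (box_bounded T X Y (partial2 v) hT hc2) as [K2 hK2].
  { intros t x y. apply Derive_ext. intros s. apply hper. }
  destruct (box_bounded T X Y (partial3 v) hT hc3) as [K3 hK3].
  { intros t x y. apply Derive_ext. intros s. apply hper. }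
  exists (Rmax 0 (Rmax K2 K3)). split; [apply Rmax_l | ].
  set (K := Rmax 0 (Rmax K2 K3)).
  assert (hle2 : K2 <= K).
  { eapply Rle_trans; [apply (Rmax_l K2 K3) | apply Rmax_r]. }
  assert (hle3 : K3 <= K).
  { eapply Rle_trans; [apply (Rmax_r K2 K3) | apply Rmax_r]. }
  assert (hseg : forall Z p q c, Rabs p <= Z -> Rabs q <= Z ->
    Rmin p q <= c <= Rmax p q -> Rabs c <= Z).
  { intros Z p q c hp hq hc. apply Rabs_le_between in hp. apply Rabs_le_between in hq.
    apply Rabs_le. unfold Rmin, Rmax in hc. destruct (Rle_dec p q); lra. }
  intros t x y x' y' hx hx' hy hy'.
  replace (v t x y - v t x' y') with ((v t x y - v t x' y) + (v t x' y - v t x' y')) by ring.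
  eapply Rle_trans; [apply Rabs_triang | ]. rewrite Rmult_plus_distr_l.
  apply Rplus_le_compat.
  - apply (mean_value_abs (fun s => v t s y) (fun s => partial2 v t s y)); intros c hc.
    + apply (Derive_correct (fun s => v t s y) c). exact (proj1 (proj2 (hd t c y))).
    + apply Rle_trans with K2; [ | exact hle2]. apply hK2; [ | exact hy].
      now apply (hseg X x' x).
  - apply (mean_value_abs (fun s => v t x' s) (fun s => partial3 v t x' s)); intros c hc.
    + apply (Derive_correct (fun s => v t x' s) c). exact (proj2 (proj2 (hd t x' c))).
    + apply Rle_trans with K3; [ | exact hle3]. apply hK3; [exact hx' | ].
      now apply (hseg Y y' y).
Qed.

(** The form in which the growth condition enters the estimate of the
    derivative. *)
Lemma abs_power_le_square (y e : R) : 1 <= Rabs y -> e <= 2 -> 0 <= abs_power y e <= y ^ 2.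
Proof.
  intros hy he. unfold abs_power. destruct (Req_EM_T y 0) as [-> | _].
  { rewrite Rabs_R0 in hy. lra. }
  split; [left; apply exp_pos | ].
  rewrite <- (pow2_abs y), <- (Rpower_pow 2) by lra.
  apply Rle_Rpower; [exact hy | simpl; lra].
Qed.

(** * The periodic solution *)

Theorem theorem3p2
  (T : R) (hT : 0 < T)
  (v : R -> R -> R -> R) (hv : smooth3 v) (hvT : periodic_in_t T v)
  (x1 x2 : R -> R)
  (hx1 : smooth x1) (hx1T : periodic T x1)
  (hx2 : smooth x2) (hx2T : periodic T x2)
  (h12 : forall t, x1 t < x2 t)
  (hlow : forall t, Derive_n x1 2 t > v t (x1 t) (Derive x1 t))
  (hupp : forall t, Derive_n x2 2 t < v t (x2 t) (Derive x2 t))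
  (a b delta : R) (hdelta : 0 < delta)
  (hbound : forall t x y, v t x y <= a + b * abs_power y (2 - delta)) :
  exists x : R -> R,
    is_solution v x /\ periodic T x /\ (forall t, x1 t < x t < x2 t).
Proof.
  assert (hd1 : forall t, ex_derive x1 t /\ ex_derive (Derive x1) t).
  { intros t. split; [exact (hx1 1%nat t) | exact (hx1 2%nat t)]. }
  assert (hd2 : forall t, ex_derive x2 t /\ ex_derive (Derive x2) t).
  { intros t. split; [exact (hx2 1%nat t) | exact (hx2 2%nat t)]. }
  change (forall t, Derive (Derive x1) t > v t (x1 t) (Derive x1 t)) in hlow.
  change (forall t, Derive (Derive x2) t < v t (x2 t) (Derive x2 t)) in hupp.
  assert (hc1 : forall t, continuous x1 t).
  { intros t. apply continuous_of_ex_derive, hd1. }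
  assert (hc2 : forall t, continuous x2 t).
  { intros t. apply continuous_of_ex_derive, hd2. }
  destruct (periodic_bounded T x1 hT hx1T hc1) as [X1 hX1].
  destruct (periodic_bounded T x2 hT hx2T hc2) as [X2 hX2].
  destruct (periodic_bounded T (Derive x1) hT (periodic_Derive T x1 hx1T)) as [Y1 hY1].
  { intros t. apply continuous_of_ex_derive, hd1. }
  destruct (periodic_bounded T (Derive x2) hT (periodic_Derive T x2 hx2T)) as [Y2 hY2].
  { intros t. apply continuous_of_ex_derive, hd2. }
  set (X := Rmax X1 X2). set (C := Rabs a + Rabs b).
  assert (hC : 0 <= C).
  { assert (h1 := Rabs_pos a). assert (h2 := Rabs_pos b). unfold C. lra. }
  (* Large enough for the truncation to leave alone the derivatives of [x1], of
     [x2], and, by [derivative_bound], of the solution. *)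
  set (M := 1 + Rabs Y1 + Rabs Y2 + exp (2 * X * C)).
  assert (hM : 1 <= M /\ Y1 <= M /\ Y2 <= M /\ exp (2 * X * C) <= M).
  { assert (h1 := Rle_abs Y1). assert (h2 := Rle_abs Y2).
    assert (h3 := Rabs_pos Y1). assert (h4 := Rabs_pos Y2).
    assert (h5 := exp_pos (2 * X * C)). unfold M. lra. }
  destruct hM as [hM1 [hMY1 [hMY2 hMexp]]].
  assert (hstrip : forall t x, x1 t <= x <= x2 t -> Rabs x <= X).
  { intros t x hx. assert (h1 := hX1 t). assert (h2 := hX2 t).
    apply Rabs_le_between in h1. apply Rabs_le_between in h2.
    assert (h3 := Rmax_l X1 X2). assert (h4 := Rmax_r X1 X2).
    apply Rabs_le. unfold X. lra. }
  set (F := fun t x y => v t (clamp (x1 t) (x2 t) x) (clamp (- M) M y)).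
  assert (hcx : forall t x, x1 t <= clamp (x1 t) (x2 t) x <= x2 t).
  { intros t x. apply clamp_bounds. left. apply h12. }
  assert (hcX : forall t x, Rabs (clamp (x1 t) (x2 t) x) <= X).
  { intros t x. apply (hstrip t), hcx. }
  assert (hcM : forall y, Rabs (clamp (- M) M y) <= M).
  { intros y. apply Rabs_le, clamp_bounds. lra. }
  assert (hidM : forall y, Rabs y <= M -> clamp (- M) M y = y).
  { intros y hy. apply clamp_id. now apply Rabs_le_between. }
  assert (hF1 : forall t, F t (x1 t) (Derive x1 t) = v t (x1 t) (Derive x1 t)).
  { intros t. unfold F. assert (h := h12 t). rewrite clamp_id by lra.
    rewrite hidM; [reflexivity | ]. eapply Rle_trans; [apply hY1 | exact hMY1]. }
  assert (hF2 : forall t x, x2 t <= x ->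
    F t x (Derive x2 t) = v t (x2 t) (Derive x2 t)).
  { intros t x hx. unfold F. assert (h := h12 t). rewrite clamp_above by lra.
    rewrite hidM; [reflexivity | ]. eapply Rle_trans; [apply hY2 | exact hMY2]. }
  assert (hFT : periodic_in_t T F).
  { intros t x y. unfold F. now rewrite hx1T, hx2T, hvT. }
  assert (hFc : forall x y t, continuous (fun s => F s x y) t).
  { intros x y t. apply (jointly_continuous_along v (fun s => clamp (x1 s) (x2 s) x)).
    - apply (hv 0%nat).
    - now apply continuous_clamp. }
  destruct (C1_lipschitz_on_box T X M v hT (hv 1%nat) hvT) as [K [hK hlip]].
  assert (hFlip : lipschitz_in_state K F).
  { intros t x y x' y'. unfold F.
    eapply Rle_trans; [apply hlip; auto | ].
    apply Rmult_le_compat_l; [exact hK | ].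
    apply Rplus_le_compat; apply clamp_lipschitz. }
  destruct (box_bounded T X M v hT (proj1 (hv 0%nat)) hvT) as [B hB].
  assert (hcomp : forall u, lower_solution T F u -> forall t, u t < x2 t).
  { intros u [hu hul]. apply (strict_comparison T); auto.
    - intros t. split; apply hul.
    - intros t hle heq. destruct (hul t) as [_ [_ h]].
      rewrite heq, hF2 in h by exact hle. specialize (hupp t). lra. }
  set (B' := Rmax B (Rmax X M)).
  assert (hB1 : B <= B') by apply Rmax_l.
  assert (hB2 : X <= B').
  { eapply Rle_trans; [apply (Rmax_l X M) | apply Rmax_r]. }
  assert (hB3 : M <= B').
  { eapply Rle_trans; [apply (Rmax_r X M) | apply Rmax_r]. }
  destruct (solution_above_lower_solution T K B' F x1) as [x [hsol [hxT hx1x]]]; auto.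
  - intros t x y. eapply Rle_trans; [apply hB; auto | exact hB1].
  - split; [exact hx1T | ]. intros t. split; [apply hd1 | split; [apply hd1 | ]].
    rewrite hF1. left. apply hlow.
  - intros t. apply Rle_trans with X; [ | exact hB2].
    apply (hstrip t). assert (h := h12 t). lra.
  - intros t. specialize (hY1 t). lra.
  - intros u hu t. apply Rle_trans with (x2 t); [left; now apply hcomp | ].
    apply Rle_trans with X; [ | exact hB2].
    assert (h := hstrip t (x2 t)). assert (h' := h12 t).
    apply Rle_trans with (Rabs (x2 t)); [apply Rle_abs | apply h; lra].
  - assert (hdx : forall t, ex_derive x t /\ ex_derive (Derive x) t).
    { intros t. split; [apply hsol | eexists; apply hsol]. }
    assert (hDDx : forall t, Derive (Derive x) t = F t (x t) (Derive x t)).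
    { intros t. apply is_derive_unique, hsol. }
    assert (hxx2 : forall t, x t < x2 t).
    { apply hcomp. split; [exact hxT | ]. intros t.
      split; [apply hdx | split; [apply hdx | ]]. rewrite hDDx. apply Rle_refl. }
    assert (hidx : forall t, clamp (x1 t) (x2 t) (x t) = x t).
    { intros t. apply clamp_id. split; [apply hx1x | left; apply hxx2]. }
    (* The bound on [v] is quadratic for [|y| >= 1], and it survives the
       truncation of [y] since [M >= 1]. *)
    assert (hquad : forall t, 1 <= Rabs (Derive x t) ->
      Derive (Derive x) t <= C * Derive x t ^ 2).
    { intros t ht. rewrite hDDx. unfold F. rewrite hidx.
      set (y := Derive x t) in *.
      assert (hz : 1 <= Rabs (clamp (- M) M y) /\ clamp (- M) M y ^ 2 <= y ^ 2).
      { destruct (Rle_dec (Rabs y) M) as [hy | hy].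
        - rewrite hidM by exact hy. lra.
        - destruct (Rle_dec 0 y) as [h0 | h0].
          + rewrite Rabs_pos_eq in hy by exact h0.
            rewrite clamp_above by lra. rewrite Rabs_pos_eq by lra. split; nra.
          + rewrite Rabs_left in hy by lra.
            rewrite clamp_below by lra. rewrite Rabs_Ropp, Rabs_pos_eq by lra. split; nra. }
      set (z := clamp (- M) M y) in *. destruct hz as [hz1 hz2].
      eapply Rle_trans; [apply hbound | ].
      destruct (abs_power_le_square z (2 - delta) hz1) as [hp1 hp2]; [lra | ].
      assert (hz3 : 1 <= z ^ 2) by (rewrite <- pow2_abs; nra).
      assert (hb := Rle_abs b). assert (ha := Rle_abs a).
      assert (hb' := Rabs_pos b). assert (ha' := Rabs_pos a).
      apply Rle_trans with (Rabs a * y ^ 2 + Rabs b * y ^ 2); [ | unfold C; lra].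
      apply Rplus_le_compat; [nra | ].
      apply Rle_trans with (Rabs b * abs_power z (2 - delta)).
      - now apply Rmult_le_compat_r.
      - apply Rmult_le_compat_l; lra. }
    assert (hDx : forall t, Rabs (Derive x t) <= M).
    { intros t. eapply Rle_trans; [ | exact hMexp].
      apply (derivative_bound T C X); auto.
      intros s. apply (hstrip s). split; [apply hx1x | left; apply hxx2]. }
    assert (hFv : forall t, F t (x t) (Derive x t) = v t (x t) (Derive x t)).
    { intros t. unfold F. now rewrite hidx, hidM. }
    assert (hx1lt : forall t, x1 t < x t).
    { apply (strict_comparison T); auto.
      intros t hle heq. assert (hxt : x t = x1 t) by (apply Rle_antisym; auto).
      rewrite hDDx, hxt, <- heq, hF1. apply hlow. }
    exists x. split; [ | split].
    + intros t. split; [apply hdx | ]. rewrite <- hFv. apply hsol.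
    + exact hxT.
    + intros t. split; [apply hx1lt | apply hxx2].
Qed.
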